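(* Let $X:g=0$ be a reduced affine hypersurface in $\mathbb{C}^n$ such that there is a derivation $$\epsilon=\alpha_1\partial_1+\cdots+\alpha_n\partial_n\in Der(X)$$ with $\epsilon g=c\cdot g$, where $c\in\mathbb{C}^*$. Then there is a direct sum decomposition $$Der(X)=Der_0(X)\oplus R\cdot\epsilon,$$ and $X$ is $A$-free if and only if $X$ is $A_0$-free.
   Context: $R=\mathbb{C}[x_1,\ldots,x_n]$, $\partial_j=\partial/\partial x_j$, and $g\in R$ is a nonconstant reduced (square-free) polynomial. $Der(R)=\{\alpha_1\partial_1+\cdots+\alpha_n\partial_n : \alpha_j\in R\}$ is the free $R$-module of $\mathbb{C}$-derivations of $R$. $Der(X)=Der(g)=\{\partial\in Der(R):\partial g\in (g)\}$ and $Der_0(X)=Der_0(g)=\{\partial\in Der(R):\partial g=0\}$ (these depend only on $X$). The hypersurface $X$ is called $A$-free (resp. $A_0$-free) if the $R$-module $Der(X)$ (resp. $Der_0(X)$) is free. *)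

(* Defs.v *)
From HB Require Import structures.
From mathcomp Require Import all_boot all_order all_algebra.
From mathcomp Require Import reals complex mpoly.

Set Implicit Arguments.
Unset Strict Implicit.
Unset Printing Implicit Defensive.

Import GRing.Theory.
Local Open Scope ring_scope.

(* Subsets and submodules of a module V are predicates V -> Prop, since
   membership need not be decidable. *)
Section FreeSubmodules.
Variables (A : nzRingType) (V : lmodType A).
Implicit Types (B M N P : V -> Prop) (v : V).

Definition lin_span B v : Prop :=
  exists (s : seq V) (a : V -> A),
    (forall b, b \in s -> B b) /\ v = \sum_(b <- s) a b *: b.

Definition lin_indep B : Prop :=
  forall (s : seq V) (a : V -> A),
    uniq s -> (forall b, b \in s -> B b) ->
    \sum_(b <- s) a b *: b = 0 -> forall b, b \in s -> a b = 0.

(* The basis B may a priori be infinite; the zero module is free, with an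
   empty basis. *)
Definition is_free M : Prop :=
  exists B, lin_indep B /\ (forall v, M v <-> lin_span B v).

Definition cyclic_submod (e : V) v : Prop := exists a : A, v = a *: e.

(* Internal direct sum: M = N + P and N, P intersect trivially. *)
Definition is_direct_sum M N P : Prop :=
  (forall v, M v <-> exists u w, [/\ N u, P w & v = u + w]) /\
  (forall v, N v -> P v -> v = 0).

End FreeSubmodules.

(* alpha_1 d_1 + ... + alpha_n d_n, encoded by its row of coefficients; Der(R)
   is then the row module, with its componentwise R-module structure. *)
Notation derivation K n := 'rV[{mpoly K[n]}]_n.

Section Hypersurfaces.
Variables (K : fieldType) (n : nat).
Implicit Types (g : {mpoly K[n]}) (d : derivation K n).

Definition der_app d g : {mpoly K[n]} := \sum_(j < n) d 0 j * mderiv j g.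

Definition nonconstant g : Prop := forall c : K, g <> c%:MP.

Definition squarefree g : Prop :=
  forall h q : {mpoly K[n]}, g = q * h ^+ 2 -> h \is a GRing.unit.

Definition Der g d : Prop := exists h : {mpoly K[n]}, der_app d g = h * g.

Definition Der0 g d : Prop := der_app d g = 0.

Definition A_free g : Prop := is_free (Der g).

Definition A0_free g : Prop := is_free (Der0 g).

End Hypersurfaces.

(* Main.v *)
(* Splitting off [eps] is the identity [d = (d - (h / c) eps) + (h / c) eps]
   when [d g = h g].  If [Der0 g] is free, adding [eps] to a basis of it gives
   a basis of [Der g].  Conversely, in a basis [d_i] of [Der g] with
   [d_i g = h_i g], [Der0 g] is the kernel of the row [(h_i)], which is
   unimodular because [eps g = c g] with [c] a unit; this kernel is free as soon
   as the row can be completed to an invertible matrix.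

   That every unimodular row over [K[x_1, ..., x_n]] is completable is the
   Quillen-Suslin theorem.  Following Suslin, a Nagata change of variables makes
   an entry of the row monic in one variable [t].  The constants [c] such that
   [f(q + c r)] and [f(q)] are equivalent for all [q] and [r] form an ideal,
   which contains every constant in the ideal generated by the first two entries
   of [f].  For each maximal ideal, the second entry can be altered by an
   elementary operation so that it becomes coprime to the monic entry in the
   residue field; their resultant is then such a constant outside the maximal
   ideal.  Hence [1] is one of these constants, [f(t)] is equivalent to [f(0)],
   and induction on [n] applies. *)

From HB Require Import structures.
Require Import Defs.
From mathcomp Require Import all_boot all_order all_algebra.
From mathcomp Require Import boolp classical_sets ring_quotient generic_quotient.
From mathcomp Require Import perm reals complex mpoly ring.

Set Implicit Arguments.
Unset Strict Implicit.
Unset Printing Implicit Defensive.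

Import GRing.Theory.
Local Open Scope ring_scope.

(** * Residue fields *)

Definition is_ideal (A : comNzRingType) (I : A -> Prop) : Prop :=
  [/\ I 0, forall x y, I x -> I y -> I (x + y) & forall a x, I x -> I (a * x)].

Lemma maximal_ideal (A : comNzRingType) (I : A -> Prop) :
  is_ideal I -> ~ I 1 ->
  exists M : A -> Prop, [/\ is_ideal M, ~ M 1, forall x, I x -> M x &
    forall x, ~ M x -> exists a m, M m /\ a * x + m = 1].
Proof.
move=> [I0 ID IM] nI1.
(* Zorn's lemma is applied to the sets [J] whose union with [I] is a proper ideal, so that the union
   of the empty chain qualifies too. *)
have [F FP FT|M [[[M0 MD MM] nM1 IsubM] maxM]] :=
    @Zorn_bigcup A [set J | [/\ is_ideal (fun x => I x \/ J x),
                               ~ (I 1 \/ J 1) & True]].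
  have inF x : (\bigcup_(X in F) X)%classic x -> exists2 X, F X & X x.
    by case=> X; exists X.
  split=> //; last first.
    by case=> // /inF [X FX X1]; case: (FP _ FX) => _ nX1 _; apply: nX1; right.
  split=> [|x y|a x]; first by left.
  - move=> [Ix|/inF[X FX Xx]] [Iy|/inF[Y FY Yy]]; first by left; apply: ID.
    + have [[_ YD _] _ _] := FP _ FY.
      by case: (YD x y); [left|right|left|move=> ?; right; exists Y].
    + have [[_ XD _] _ _] := FP _ FX.
      by case: (XD x y); [right|left|left|move=> ?; right; exists X].
    + have [XY|YX] := FT _ _ FX FY.
        have [[_ YD _] _ _] := FP _ FY.
        case: (YD x y); [by right; apply: XY|by right|by left|].
        by move=> ?; right; exists Y.
      have [[_ XD _] _ _] := FP _ FX.
      case: (XD x y); [by right|by right; apply: YX|by left|].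
      by move=> ?; right; exists X.
  - case=> [Ix|/inF[X FX Xx]]; first by left; apply: IM.
    have [[_ _ XM] _ _] := FP _ FX.
    by case: (XM a x); [right|left|move=> ?; right; exists X].
exists (fun x => I x \/ M x); split=> //; first by left.
move=> x nMx; apply: contrapT => nex.
(* If [x] had no inverse modulo the ideal, then [J], generated by [I], [M] and [x], would still be
   proper, against the maximality of [M]. *)
pose J y := exists a m, (I m \/ M m) /\ y = a * x + m.
have Jx : J x by exists 1, 0; rewrite mul1r addr0.
have MJ : (M `<` J)%classic.
  split=> [y My|/(_ x Jx) //]; last by move=> ?; apply: nMx; right.
  by exists 0, y; rewrite mul0r add0r; split; first by right.
apply: (maxM _ MJ).
have IJ y : I y -> J y.
  by move=> Iy; exists 0, y; rewrite mul0r add0r; split; first by left.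
have IJE y : (I y \/ J y) -> J y by case; [exact: IJ|].
split=> //; last first.
  by move/IJE => [a [m [Mm E]]]; apply: nex; exists a, m; rewrite -E.
split=> [|y z /IJE [a [m [Mm ->]]] /IJE [b [l [Ml ->]]]|b y /IJE [a [m [Mm ->]]]].
- by left.
- right; exists (a + b), (m + l); split; first exact: MD.
  by rewrite mulrDl addrACA.
- right; exists (b * a), (b * m); split; first exact: MM.
  by rewrite mulrDr mulrA.
Qed.

Lemma residue_field (A : comNzRingType) (I : A -> Prop) :
  is_ideal I -> ~ I 1 ->
  exists (k : fieldType) (phi : {rmorphism A -> k}),
    (forall y, exists x, phi x = y) /\ forall x, I x -> phi x = 0.
Proof.
move=> idI /(maximal_ideal idI)[M [[M0 MD MM] nM1 IsubM maxM]].
pose S : pred A := fun x => `[< M x >].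
have SP : idealr_closed S.
  split; rewrite ?unfold_in ?/S; [exact/asboolP|exact/asboolPn|].
  move=> a x y; rewrite !unfold_in => /asboolP Mx /asboolP My.
  by apply/asboolP/MD/My/MM.
pose S' : idealr A := HB.pack S (isIdealr.Build A S SP).
pose Q := {ideal_quot S'}.
pose proj : {rmorphism A -> Q} := (\pi_Q)%qT.
have projE x : (proj x == 0) = S x.
  by rewrite -(rmorph0 proj) /= -Quotient.idealrBE subr0.
have invQ (x : Q) : exists y : Q, (x != 0 -> y * x = 1) /\ (x = 0 -> y = 0).
  have [->|nx0] := eqVneq x 0; first by exists 0; split.
  have /asboolPn/maxM [a [m [Mm E]]] : ~~ S (repr x).
    apply: contra nx0 => Sx; rewrite -[x]reprK.
    by rewrite [_ == _](projE (repr x)).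
  exists (proj a); split=> [_|/eqP]; last by rewrite (negPf nx0).
  have -> : x = proj (repr x) by rewrite /= reprK.
  by apply/eqP; rewrite -rmorphM -(rmorph1 proj) -subr_eq0 -rmorphB projE -E
    opprD addNKr; apply/asboolP; rewrite -mulN1r; apply: MM.
pose inv (x : Q) := sval (cid (invQ x)).
have mulVf x : x != 0 -> inv x * x = 1.
  by move=> nx0; case: (svalP (cid (invQ x))) => /(_ nx0).
have inv0 : inv 0 = 0 by exact: (proj2 (svalP (cid (invQ 0))) erefl).
pose k : fieldType := HB.pack Q (GRing.ComNzRing_isField.Build Q mulVf inv0).
exists k, proj; split=> [y|x /IsubM Mx]; first by exists (repr y); exact: reprK.
by apply/eqP; rewrite [_ == _](projE x); apply/asboolP.
Qed.

(** * Resultants outside a maximal ideal *)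

(** For [q != 0], let [v] be the largest factor of [p] prime to [q]. A common divisor of [p] and
    [q + v * h] is prime to [v], and also to [q]: what it shares with [q] divides [v * h], hence
    [h], hence 1. Since [p] divides [v] times a power of [q], this divisor is a unit. *)
Lemma coprimep_stable_range (k : fieldType) (p q h u1 u2 : {poly k}) :
  p != 0 -> u1 * p + u2 * q + h = 1 -> exists v, coprimep p (q + v * h).
Proof.
move=> p0 E.
(* If [q = 0], the relation itself makes [h] a unit modulo [p]. *)
have [q0|q0] := eqVneq q 0.
  exists 1; rewrite q0 add0r mul1r; apply/Bezout_coprimepP.
  by exists (u1, 1); rewrite /= mul1r -E q0 mulr0 addr0 eqpxx.
exists (gdcop q p); set v := gdcop q p; set w := q + v * h.
set d := gcdp p w.
have dp : d %| p := dvdp_gcdl p w.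
have dw : d %| w := dvdp_gcdr p w.
have vq : coprimep v q by apply: coprimep_gdco.
have vw : coprimep v w by rewrite /w addrC mulrC coprimep_addl_mul.
have dv : coprimep d v by apply: coprimep_dvdr dw _; rewrite coprimep_sym.
have dq : coprimep d q.
  rewrite /coprimep -dvdp1 -E; set e := gcdp d q.
  have ed : e %| d := dvdp_gcdl d q.
  have eq : e %| q := dvdp_gcdr d q.
  have ev : coprimep e v := coprimep_dvdr ed dv.
  have eh : e %| h.
    rewrite -(Gauss_dvdpr h ev) -(dvdp_addr (v * h) eq).
    exact: dvdp_trans ed dw.
  rewrite dvdp_add // dvdp_add // dvdp_mull //.
  exact: dvdp_trans ed dp.
rewrite /coprimep -/d -dvdp1 -(Gauss_dvdpr 1 (coprimep_expr (size p) dq)) mulr1.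
by rewrite -(Gauss_dvdpr _ dv); apply: dvdp_trans dp _; apply: dvdp_gdcor.
Qed.

(* The library lemma [map_resultant] only covers polynomials over a polynomial
   ring. *)
Lemma resultant_map_monic (A B : nzRingType) (f : {rmorphism A -> B})
    (p q : {poly A}) : p \is monic -> q \is monic ->
  f (resultant p q) = resultant (map_poly f p) (map_poly f q).
Proof.
move=> /monicP p1 /monicP q1; rewrite /resultant /Sylvester_mx.
rewrite !size_map_poly_id0 ?p1 ?q1 ?rmorph1 ?oner_eq0 //.
rewrite -det_map_mx map_col_mx; congr (\det (col_mx _ _));
  by apply: map_lin1_mx => v; rewrite map_poly_rV rmorphM /= map_rVpoly.
Qed.

(** This replaces [w] by a monic polynomial without changing the ideal generated by [p] and [w];
    between monic polynomials, the resultant commutes with reduction to a residue field. *)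
Lemma monic_add_shift (A : nzRingType) (p w : {poly A}) :
  p \is monic -> w + 'X^(size w) * p \is monic.
Proof.
move=> mp; have szp : size ('X^(size w) * p) = (size w + size p)%N.
  by rewrite size_Mmonic ?monic_neq0 ?monicXn // size_polyXn.
rewrite monicE addrC lead_coefDl; first by rewrite lead_coef_Mmonic // lead_coefXn.
by rewrite szp -[X in (X < _)%N]addn0 ltn_add2l size_poly_gt0 monic_neq0.
Qed.

(** In positive degrees this is [resultant_in_ideal]; a constant monic polynomial is 1 and generates
    everything. *)
Lemma resultant_monic_in_ideal (A : comNzRingType) (p q : {poly A}) :
  p \is monic -> q \is monic ->
  exists u v, (resultant p q)%:P = u * p + v * q.
Proof.
have mon1 (r : {poly A}) : r \is monic -> ~~ (1 < size r)%N -> r = 1.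
  move=> mr; rewrite -leqNgt => /size1_polyC r_const; move: mr.
  by rewrite r_const monicE lead_coefC => /eqP ->.
move=> mp mq; have [p_gt1|/(mon1 p mp) ->] := boolP (1 < size p)%N.
  have [q_gt1|/(mon1 q mq) ->] := boolP (1 < size q)%N.
    by have [[u v] _ E] := resultant_in_ideal p_gt1 q_gt1; exists u, v.
  by exists 0, (resultant p 1)%:P; rewrite mul0r add0r mulr1.
by exists (resultant 1 q)%:P, 0; rewrite mul0r addr0 mulr1.
Qed.

(** The coprimality obtained over [k] lifts through the surjection [phi]: [c] is the resultant of
    [p] with a monic representative of [q + v * h] modulo [p], and [phi c] is the resultant of two
    coprime polynomials. In the application, [h] collects the remaining entries of a unimodular
    row. *)
Lemma residual_resultant (A : comNzRingType) (k : fieldType)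
    (phi : {rmorphism A -> k}) (p q h u1 u2 : {poly A}) :
  (forall y, exists x, phi x = y) -> p \is monic ->
  u1 * p + u2 * q + h = 1 ->
  exists v, exists c : A, phi c != 0 /\
    exists a b, c%:P = a * p + b * (q + v * h).
Proof.
move=> phi_surj mp E.
have phiP y : exists x, map_poly phi x = y.
  pose g z := sval (cid (phi_surj z)).
  have gK z : phi (g z) = z := svalP (cid (phi_surj z)).
  exists (\poly_(i < size y) g y`_i); apply/polyP => i.
  rewrite coef_map coef_poly; case: ltnP => [_|ly]; first exact: gK.
  by rewrite [LHS](rmorph0 phi) nth_default.
have mpk : map_poly phi p \is monic by apply: monic_map.
have [] := @coprimep_stable_range _ (map_poly phi p) (map_poly phi q)
  (map_poly phi h) (map_poly phi u1) (map_poly phi u2).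
- exact: monic_neq0.
- by rewrite -!rmorphM -!rmorphD E rmorph1.
move=> vk; have [v <-] := phiP vk => cop.
set w := q + v * h; set w' := w + 'X^(size w) * p.
have mw : w' \is monic by apply: monic_add_shift.
exists v, (resultant p w'); split.
  rewrite resultant_map_monic // resultant_eq0 -leqNgt leq_eqVlt; apply/orP; left.
  rewrite -[_ == _]/(coprimep _ _) rmorphD rmorphM /= addrC coprimep_addl_mul.
  by rewrite rmorphD rmorphM.
have [a [b ->]] := resultant_monic_in_ideal mp mw.
by exists (a + b * 'X^(size w)), b; rewrite -/w /w'; ring.
Qed.

(** * Suslin's descent from [A[t]] to [A] *)

Definition row_equiv (A : comUnitRingType) m (f g : 'rV[A]_m) : Prop :=
  exists2 P : 'M[A]_m, P \in unitmx & f = g *m P.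

Lemma row_equiv_refl (A : comUnitRingType) m (f : 'rV[A]_m) : row_equiv f f.
Proof. by exists 1%:M; rewrite ?unitmx1 ?mulmx1. Qed.

Lemma row_equiv_sym (A : comUnitRingType) m (f g : 'rV[A]_m) :
  row_equiv f g -> row_equiv g f.
Proof. by case=> P uP ->; exists (invmx P); rewrite ?unitmx_inv ?mulmxK. Qed.

Lemma row_equiv_trans (A : comUnitRingType) m (f g h : 'rV[A]_m) :
  row_equiv f g -> row_equiv g h -> row_equiv f h.
Proof.
case=> P uP -> [Q uQ ->]; exists (Q *m P); last by rewrite mulmxA.
by rewrite unitmx_mul uQ.
Qed.

Lemma row_equiv_map (A B : comUnitRingType) (phi : {rmorphism A -> B}) m
    (f g : 'rV[A]_m) :
  row_equiv f g -> row_equiv (map_mx phi f) (map_mx phi g).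
Proof.
case=> P uP ->; exists (map_mx phi P); last by rewrite map_mxM.
by rewrite unitmxE det_map_mx rmorph_unit // -unitmxE.
Qed.

Lemma row_equiv_addl (A : comUnitRingType) p q (x : 'rV[A]_p) (y : 'rV[A]_q) V :
  row_equiv (row_mx (x + y *m V) y) (row_mx x y).
Proof.
exists (block_mx 1%:M 0 V 1%:M).
  by rewrite unitmxE det_lblock !det1 mulr1 unitr1.
by rewrite mul_row_block !mulmx1 mulmx0 add0r.
Qed.

Lemma row_equiv_addr (A : comUnitRingType) p q (x : 'rV[A]_p) (y : 'rV[A]_q) V :
  row_equiv (row_mx x (y + x *m V)) (row_mx x y).
Proof.
exists (block_mx 1%:M V 0 1%:M).
  by rewrite unitmxE det_ublock !det1 mulr1 unitr1.
by rewrite mul_row_block !mulmx1 mulmx0 addr0 addrC.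
Qed.

Lemma row_equiv_mull (A : comUnitRingType) p q (x : 'rV[A]_p) (y : 'rV[A]_q) M :
  M \in unitmx -> row_equiv (row_mx (x *m M) y) (row_mx x y).
Proof.
move=> uM; exists (block_mx M 0 0 1%:M).
  by rewrite unitmxE det_ublock det1 mulr1 -unitmxE.
by rewrite mul_row_block !mulmx1 !mulmx0 addr0 add0r.
Qed.

Definition row2 (A : nmodType) (x y : A) : 'rV[A]_2 :=
  \row_j (if j == 0 then x else y).

Lemma row2E (A : nmodType) (x : 'rV[A]_2) : x = row2 (x 0 0) (x 0 1).
Proof.
apply/rowP => j; rewrite mxE.
by case: j => [[|[|j]] Hj] //=; congr (x 0 _); exact: val_inj.
Qed.

Lemma sum_ord2 (A : nmodType) (F : 'I_2 -> A) : \sum_i F i = F 0 + F 1.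
Proof. by rewrite big_ord_recl big_ord1; congr (_ + F _); exact: val_inj. Qed.

Lemma comp_poly_sub_dvd (A : comNzRingType) (c : A) (p q r : {poly A}) :
  exists s, p \Po (q + c%:P * r) = p \Po q + c%:P * s.
Proof.
elim/poly_ind: p => [|p k [s E]]; first by exists 0; rewrite !comp_poly0 mulr0 addr0.
exists ((p \Po q) * r + s * (q + c%:P * r)).
by rewrite !comp_poly_MXaddC E; ring.
Qed.

(** Let [N] have rows [(x0, x1)] and [(-b, a)], and let [N'] be its analogue for the shifted data.
    Both have determinant [c] and they agree modulo [c], so [N^-1 * N' = 1 + adj(N) * (N' - N) / c]
    has entries in [A] and determinant 1; this is the matrix [M]. *)
Lemma row2_equiv (A : idomainType) (c a b x0 x1 a' b' X0 X1 : A) :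
  c != 0 -> a * x0 + b * x1 = c ->
  (a + c * a') * (x0 + c * X0) + (b + c * b') * (x1 + c * X1) = c ->
  exists2 M : 'M[A]_2, M \in unitmx &
    row2 (x0 + c * X0) (x1 + c * X1) = row2 x0 x1 *m M.
Proof.
move=> c0 E1 E2.
(* This is the difference of the two relations divided by [c]; it is also [\det M - 1]. *)
have S0 : a * X0 + b * X1 + a' * x0 + b' * x1 + c * (a' * X0 + b' * X1) = 0.
  apply: (mulfI c0); rewrite mulr0; apply/(addrI c); rewrite addr0 -[RHS]E2 -{1}E1.
  ring.
pose M : 'M[A]_2 := \matrix_(i, j)
  if i == 0 then if j == 0 then 1 + X0 * a + b' * x1 else X1 * a - a' * x1
  else if j == 0 then X0 * b - b' * x0 else 1 + X1 * b + a' * x0.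
have detM : \det M = 1.
  rewrite (expand_det_row _ 0) big_ord_recl big_ord1 /cofactor !det_mx11 !mxE /=.
  by rewrite -[RHS]addr0 -S0 expr0 expr1 -E1; ring.
exists M; first by rewrite unitmxE detM unitr1.
apply/rowP => j; rewrite mxE [RHS]mxE sum_ord2 !mxE /=.
by case: ifP => _; rewrite -E1; ring.
Qed.

Definition row_at (A : comNzRingType) m (q : {poly A}) (f : 'rV[{poly A}]_m) :=
  map_mx (comp_poly q) f.

(** Shifting the argument by [c%:P * r] changes every entry by a multiple of [c]. For the entries of
    [y] such a multiple is a combination of the two entries of [x], which column operations remove;
    the pair [x] itself is handled by [row2_equiv]. *)
Lemma row_at_shift (A : idomainType) m (c : A) (x : 'rV[{poly A}]_2)
    (y : 'rV[{poly A}]_m) (a b q r : {poly A}) :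
  c%:P = a * x 0 0 + b * x 0 1 ->
  row_equiv (row_at (q + c%:P * r) (row_mx x y)) (row_at q (row_mx x y)).
Proof.
move=> E; have [->|c0] := eqVneq c 0.
  by rewrite mul0r addr0; exact: row_equiv_refl.
have cP0 : c%:P != 0 by rewrite polyC_eq0.
rewrite /row_at !map_row_mx; set q' := q + _.
have Ea : (a \Po q) * (x 0 0 \Po q) + (b \Po q) * (x 0 1 \Po q) = c%:P.
  by rewrite -!comp_polyM -comp_polyD -E comp_polyC.
have Eg : (a \Po q') * (x 0 0 \Po q') + (b \Po q') * (x 0 1 \Po q') = c%:P.
  by rewrite -!comp_polyM -comp_polyD -E comp_polyC.
apply: (@row_equiv_trans _ _ _
  (row_mx (map_mx (comp_poly q') x) (map_mx (comp_poly q) y))).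
  pose s j := sval (cid (comp_poly_sub_dvd c (y 0 j) q r)).
  have sP j : y 0 j \Po q' = y 0 j \Po q + c%:P * s j :=
    svalP (cid (comp_poly_sub_dvd c (y 0 j) q r)).
  have -> : map_mx (comp_poly q') y = map_mx (comp_poly q) y +
      map_mx (comp_poly q') x *m ((row2 (a \Po q') (b \Po q'))^T *m \row_j s j).
    apply/rowP => j; rewrite mulmxA !mxE sP -Eg; congr (_ + _).
    rewrite big_ord1 !mxE; congr (_ * _).
    by rewrite sum_ord2 !mxE /= mulrC [X in _ + X]mulrC.
  exact: row_equiv_addr.
have [X0 EX0] := comp_poly_sub_dvd c (x 0 0) q r.
have [X1 EX1] := comp_poly_sub_dvd c (x 0 1) q r.
have [a' EA] := comp_poly_sub_dvd c a q r.
have [b' EB] := comp_poly_sub_dvd c b q r.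
rewrite -/q' in EX0 EX1 EA EB; rewrite EX0 EX1 EA EB in Eg.
have [M uM EM] := row2_equiv cP0 Ea Eg.
rewrite [map_mx (comp_poly q') x]row2E [map_mx (comp_poly q) x]row2E !mxE.
by rewrite EX0 EX1 EM; exact: row_equiv_mull.
Qed.

Lemma row_equiv_horner0 (A : idomainType) m (f : 'rV[{poly A}]_(2 + m)) u :
  f 0 0 \is monic -> f *m u = 1%:M -> row_equiv f (row_at 0 f).
Proof.
rewrite -[f]hsubmxK -[u]vsubmxK.
move: (lsubmx f) (rsubmx f) (usubmx u) (dsubmx u) => x y ux uy mf.
have mx : x 0 0 \is monic.
  by move: mf; rewrite -(row_mxEl x y 0 0); congr (_ _ _ \is monic); exact: val_inj.
rewrite mul_row_col => /matrixP /(_ 0 0); rewrite mxE [X in X + _]mxE.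
(* [h] is the share of the entries after the second in the relation [f *m u = 1]. *)
set h : {poly A} := (y *m uy) 0 0.
rewrite sum_ord2 mxE.
rewrite mulrC [x 0 1 * _]mulrC => E.
pose I c := forall q r, row_equiv (row_at (q + c%:P * r) (row_mx x y))
                                  (row_at q (row_mx x y)).
have I1 : I 1.
  apply: contrapT => nI1.
  have idI : is_ideal I.
    split=> [q r|c d Ic Id q r|a c Ic q r].
    - by rewrite mul0r addr0; exact: row_equiv_refl.
    - rewrite polyCD mulrDl addrA; exact: row_equiv_trans (Id _ _) (Ic _ _).
    - by rewrite [a * c]mulrC polyCM -mulrA; exact: Ic.
  have [k [phi [phi_surj phiI]]] := residue_field idI nI1.
  have [v [c [phic [a [b Ec]]]]] := residual_resultant phi_surj mx E.
  apply/negP: phic; rewrite phiI ?eqxx // => q r.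
  (* [y *m V] is the row [(0, h * v)], so the second entry is altered by a combination of the
     entries of [y]; the equivalence persists under evaluation at any [q']. *)
  pose V := uy *m row2 0 v.
  have eqf : row_equiv (row_mx (x + y *m V) y) (row_mx x y) by exact: row_equiv_addl.
  have eqf' q' := row_equiv_map (comp_poly q') eqf.
  apply: row_equiv_trans (row_equiv_sym (eqf' _)) _.
  apply: row_equiv_trans (eqf' _).
  apply: row_at_shift; rewrite Ec mulmxA [y *m uy]mx11_scalar -/h mul_scalar_mx.
  by rewrite !mxE /= mulr0 addr0 [h * v]mulrC.
(* The value at ['X] is [f] itself. *)
have := I1 0 'X; rewrite add0r mul1r => Hf.
by rewrite {1}(_ : row_mx x y = row_at 'X (row_mx x y)) //; apply/rowP => j;
  rewrite !mxE comp_polyXr.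
Qed.

(** * Nagata's change of variables *)

(** Reduction modulo [N] isolates the lowest digit, and division by [N] leaves the others. This will
    separate the degrees of the images of monomials. *)
Lemma digits_inj (N k : nat) (a b : nat -> nat) :
  (forall i, a i < N)%N -> (forall i, b i < N)%N ->
  (\sum_(i < k) a i * N ^ i = \sum_(i < k) b i * N ^ i)%N ->
  forall i, (i < k)%N -> a i = b i.
Proof.
elim: k a b => [|k IH] a b aN bN //; rewrite !big_ord_recl !muln1.
have shift c : (\sum_(i < k) c (bump 0 i) * N ^ bump 0 i =
                (\sum_(i < k) c i.+1 * N ^ i) * N)%N.
  by rewrite big_distrl; apply: eq_bigr => i _; rewrite /= /bump add1n expnSr mulnA.
rewrite !shift => E.
have N0 : (0 < N)%N by apply: leq_ltn_trans (aN 0).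
have E0 : a 0 = b 0.
  have := congr1 (modn^~ N) E.
  by rewrite ![(_ 0 + _)%N]addnC !modnMDl !modn_small.
move: E; rewrite E0 => /addnI /eqP; rewrite eqn_pmul2r // => /eqP E [|i] //=.
by rewrite ltnS; apply: (IH (a \o S) (b \o S)) => // j; [apply: aN|apply: bN].
Qed.

(** The summand of largest size dominates: no other can cancel its leading term. *)
Lemma lead_coef_sum_distinct (A : nzRingType) (T : eqType) (F : T -> {poly A}) s :
  s != [::] -> uniq [seq size (F m) | m <- s] ->
  exists2 m, m \in s & lead_coef (\sum_(m <- s) F m) = lead_coef (F m) /\
                       size (\sum_(m <- s) F m) = size (F m).
Proof.
elim: s => [//|x [|y s] IH] _.
  by exists x; rewrite ?inE // big_seq1.
move=> /= /andP[nx /(IH isT)[m ms [lm sm]]]; rewrite big_cons.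
set S := \sum_(m <- _) _ in lm sm *.
have : size (F x) != size S.
  rewrite sm; apply: contraNneq nx => ->.
  exact: (map_f (fun z => size (F z)) ms).
rewrite neq_ltn => /orP[lt|lt].
- exists m; first by rewrite inE ms orbT.
  by rewrite lead_coefDr // lm addrC size_polyDl.
- by exists x; rewrite ?mem_head // lead_coefDl // size_polyDl.
Qed.

Lemma mpoly_rmorph_ext (K : comNzRingType) n (S : comNzRingType)
    (f g : {rmorphism {mpoly K[n]} -> S}) :
  (forall c, f c%:MP = g c%:MP) -> (forall i, f 'X_i = g 'X_i) -> f =1 g.
Proof.
move=> fC fX p; rewrite [p]mpolyE !rmorph_sum; apply: eq_bigr => m _.
rewrite -mul_mpolyC !rmorphM fC mpolyXE_id !rmorph_prod; congr (_ * _).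
by apply: eq_bigr => i _; rewrite !rmorphXn fX.
Qed.

(** Variable 0 becomes ['X], of degree [N ^ 0]. The degree of the image of a monomial is thus the
    number with its exponents as base-[N] digits, once [N] exceeds them. *)
Definition nagata_var (K : fieldType) (N n : nat) (i : 'I_n.+1) :
    {poly {mpoly K[n]}} :=
  if unlift ord0 i is Some j then 'X^(N ^ i) + ('X_j)%:P else 'X.

Definition nagata (K : fieldType) (N n : nat) :
    {rmorphism {mpoly K[n.+1]} -> {poly {mpoly K[n]}}} :=
  mmap (polyC \o @mpolyC n K) (@nagata_var K N n).

Definition nagata_inv (K : fieldType) (N n : nat) :
    {rmorphism {poly {mpoly K[n]}} -> {mpoly K[n.+1]}} :=
  horner_eval 'X_ord0 \o map_poly (mmap (@mpolyC n.+1 K)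
    (fun j => 'X_(lift ord0 j) - 'X_ord0 ^+ (N ^ lift ord0 j))).

Lemma nagataK (K : fieldType) (N n : nat) :
  cancel (nagata K N n) (nagata_inv K N n).
Proof.
apply: (@mpoly_rmorph_ext K _ _ (nagata_inv K N n \o nagata K N n) idfun)
  => [c|i] /=.
  by rewrite mmapC /= map_polyC /horner_eval hornerC /= mmapC.
rewrite mmapX mmap1U /nagata_var /horner_eval; case: unliftP => [j ->|->].
  rewrite rmorphD /= map_polyXn map_polyC hornerD hornerXn hornerC /=.
  by rewrite mmapX mmap1U addrC subrK.
by rewrite map_polyX hornerX.
Qed.

Lemma nagata_var_monic (K : fieldType) (N n : nat) (i : 'I_n.+1) : (0 < N)%N ->
  nagata_var K N i \is monic /\ size (nagata_var K N i) = (N ^ i).+1.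
Proof.
move=> N0; rewrite /nagata_var; case: unliftP => [j ->|->]; last first.
  by rewrite monicX size_polyX.
have lt : (size ('X_j : {mpoly K[n]})%:P <
    size ('X^(N ^ lift ord0 j) : {poly {mpoly K[n]}}))%N.
  by rewrite size_polyXn ltnS (leq_trans (size_polyC_leq1 _)) // expn_gt0 N0.
by rewrite monicE lead_coefDl // lead_coefXn size_polyDl // size_polyXn.
Qed.

Lemma nagata_monomial (K : fieldType) (N n : nat) (m : 'X_{1..n.+1}) : (0 < N)%N ->
  nagata K N n 'X_[m] \is monic /\
  size (nagata K N n 'X_[m]) = (\sum_(i < n.+1) m i * N ^ i).+1.
Proof.
move=> N0; rewrite /nagata /= mmapX /mmap1.
elim/big_rec2: _ => [|i k q _ [mq sq]]; first by rewrite monic1 size_poly1.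
have [mv sv] := @nagata_var_monic K N n i N0.
have mvi : nagata_var K N i ^+ m i \is monic by apply: monic_exp.
split; first by rewrite monicMl.
rewrite size_Mmonic ?monic_neq0 // sq addnS /=.
have -> : size (nagata_var K N i ^+ m i) = (m i * N ^ i).+1; last by rewrite addSn.
have := size_exp (nagata_var K N i) (m i); rewrite sv /= mulnC => <-.
by rewrite prednK // size_poly_gt0 monic_neq0.
Qed.

(* With [N] larger than every exponent, distinct monomials of [p] are sent to
   monic polynomials of distinct degrees. *)
Lemma nagata_monic (K : fieldType) n (p : {mpoly K[n.+1]}) : p != 0 ->
  exists N c, c != 0 /\ c%:MP%:P * nagata K N n p \is monic.
Proof.
move=> p0; pose N := msize p.
have N0 : (0 < N)%N by rewrite lt0n msize_poly_eq0.
have ltN m (i : 'I_n.+1) : m \in msupp p -> (m i < N)%N.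
  move=> /msize_mdeg_lt; apply: leq_ltn_trans.
  by rewrite mdegE (bigD1 i) //= leq_addr.
pose F m := (p@_m)%:MP%:P * nagata K N n 'X_[m].
have Fsum : nagata K N n p = \sum_(m <- msupp p) F m.
  rewrite {1}[p]mpolyE rmorph_sum; apply: eq_bigr => m _.
  by rewrite -mul_mpolyC rmorphM /= mmapC.
have cm m : m \in msupp p -> (p@_m)%:MP != 0 :> {mpoly K[n]}.
  by rewrite mcoeff_msupp mpolyC_eq0.
have sizeF m : m \in msupp p -> size (F m) = (\sum_(i < n.+1) m i * N ^ i).+1.
  move=> /cm c0; have [mm sm] := @nagata_monomial K N n m N0.
  by rewrite /F mul_polyC size_scale // sm.
have leadF m : m \in msupp p -> lead_coef (F m) = (p@_m)%:MP.
  move=> /cm c0; have [mm sm] := @nagata_monomial K N n m N0.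
  by rewrite /F lead_coef_Mmonic // lead_coefC.
have [] := @lead_coef_sum_distinct _ _ F (msupp p).
- by rewrite msupp_eq0.
- rewrite map_inj_in_uniq; first exact: msupp_uniq.
  move=> m m' Hm Hm'.
  move/(etrans (esym (sizeF m Hm)))/esym/(etrans (esym (sizeF m' Hm'))).
  move/esym/succn_inj => E.
  apply/mnmP => i.
  (* [digits_inj] takes digits indexed by all of [nat], so exponents are extended by 0. *)
  pose a (m : 'X_{1..n.+1}) j := if (j < n.+1)%N then m (inord j) else 0%N.
  have aN m1 j : m1 \in msupp p -> (a m1 j < N)%N.
    by move=> H; rewrite /a; case: ifP => // _; apply: ltN.
  have aE m1 (j : 'I_n.+1) : a m1 j = m1 j by rewrite /a ltn_ord inord_val.
  rewrite -!aE; apply: (@digits_inj N n.+1) => // [j|j|]; try exact: aN.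
  have sumE m1 : (\sum_(j < n.+1) a m1 j * N ^ j = \sum_(j < n.+1) m1 j * N ^ j)%N.
    by apply: eq_bigr => j _; rewrite aE.
  by rewrite !sumE.
(* The scalar is the inverse of the coefficient of the dominant monomial. *)
move=> m Hm [lm _]; exists N, (p@_m)^-1; split.
  by rewrite invr_eq0 -mcoeff_msupp.
rewrite monicE Fsum mul_polyC lead_coefZ lm leadF //.
by rewrite -mpolyCM mulVf // -mcoeff_msupp.
Qed.

(** * Completion of unimodular rows *)

Lemma row_equiv_xcol (A : comUnitRingType) m (f : 'rV[A]_m) i j :
  row_equiv (xcol i j f) f.
Proof. by exists (tperm_mx i j); rewrite ?unitmx_perm ?xcolE. Qed.

Lemma row_equiv_scale (A : comUnitRingType) m (f : 'rV[A]_m) a :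
  a \is a GRing.unit -> row_equiv (a *: f) f.
Proof.
by move=> ua; exists a%:M; rewrite ?mul_mx_scalar // unitmxE det_scalar unitrX.
Qed.

Lemma row_equiv_unit_entry (A : comUnitRingType) m (f : 'rV[A]_m.+1) j :
  f 0 j \is a GRing.unit -> row_equiv f (delta_mx 0 0).
Proof.
move=> uj; apply: row_equiv_trans (row_equiv_sym (row_equiv_xcol f 0 j)) _.
have : xcol 0 j f 0 0 \is a GRing.unit by rewrite mxE tpermL.
move: (xcol 0 j f); change m.+1 with (1 + m)%N => {uj}g.
rewrite -[g]hsubmxK; move: (lsubmx g) (rsubmx g) => x y.
have -> : row_mx x y 0 0 = x 0 0.
  by rewrite -(row_mxEl x y 0 0); congr (_ _ _); exact: val_inj.
rewrite [x]mx11_scalar; move: (x 0 0) => a; rewrite mxE mulr1n => ua.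
have -> : delta_mx 0 0 = row_mx 1%:M 0 :> 'rV[A]_(1 + m).
  apply/rowP => k; rewrite mxE eqxx /=; case: (splitP k) => i E.
    have -> : k = lshift m i by exact: val_inj.
    by rewrite row_mxEl mxE (ord1 i).
  have -> : k = rshift 1 i by exact: val_inj.
  by rewrite row_mxEr mxE.
apply: (@row_equiv_trans _ _ _ (row_mx a%:M 0)).
  have := row_equiv_addr a%:M 0 (a^-1 *: y).
  by rewrite add0r mul_scalar_mx scalerA divrr // scale1r.
rewrite -[X in row_equiv (row_mx X _)]mul1mx; apply: row_equiv_mull.
by rewrite unitmxE det_scalar unitrX.
Qed.

Lemma mpoly0_unit (K : fieldType) (p : {mpoly K[0]}) : p != 0 -> p \is a GRing.unit.
Proof.
have -> : p = (p@_0)%:MP.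
  apply/mpolyP => m; rewrite (_ : m = 0%MM); last by apply/mnmP => -[].
  by rewrite mcoeffC eqxx mulr1.
by rewrite mpolyC_eq0 -unitfE => u; exact: (rmorph_unit (@mpolyC 0 K)).
Qed.

(** Equivalence with [delta_mx 0 0] says that [f] is the first row of an invertible matrix. *)
Lemma unimodular_row_completable (K : fieldType) n m
    (f : 'rV[{mpoly K[n]}]_m.+1) u :
  f *m u = 1%:M -> row_equiv f (delta_mx 0 0).
Proof.
(* A zero row cannot satisfy [f *m u = 1]; without variables, a nonzero entry is already a unit. *)
elim: n m f u => [|n IH] m f u fu;
  have [j fj] : exists j, f 0 j != 0; try by
    apply/existsP; apply: contraT => /existsPn f0;
    move/matrixP/(_ 0 0): fu => /eqP; rewrite !mxE big1 ?eqxx 1?eq_sym ?oner_eq0 //;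
    move=> i _; have := f0 i; rewrite negbK => /eqP ->; rewrite mul0r.
  by apply: (@row_equiv_unit_entry _ _ _ j); apply: mpoly0_unit.
apply: row_equiv_trans (row_equiv_sym (row_equiv_xcol f 0 j)) _.
have {fj} : xcol 0 j f 0 0 != 0 by rewrite mxE tpermL.
have {fu} : xcol 0 j f *m (xrow 0 j u) = 1%:M.
  by rewrite xcolE xrowE mulmxA -[_ *m _ *m tperm_mx _ _]mulmxA -perm_mxM
    tperm2 perm_mx1 mulmx1.
move: (xcol 0 j f) (xrow 0 j u) => {j}{}f {}u fu f00.
(* A row of length 1 consists of a unit; longer rows have the two leading entries required by the
   descent. *)
case: m => [|m] in f u fu f00 *.
  apply: (@row_equiv_unit_entry _ _ _ 0).
  move/matrixP/(_ 0 0): fu; rewrite !mxE big_ord1 => E.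
  by apply/unitrPr; exists (u 0 0).
have [N [c [c0 mf]]] := nagata_monic f00.
have uc : (c%:MP : {mpoly K[n.+1]}) \is a GRing.unit.
  by apply: (rmorph_unit (@mpolyC n.+1 K)); rewrite unitfE.
apply: row_equiv_trans (row_equiv_sym (row_equiv_scale f uc)) _.
pose F := map_mx (nagata K N n) (c%:MP *: f).
(* Ring morphisms fix [delta_mx 0 0], so [nagata_inv] carries the equivalence back. *)
suff H : row_equiv F (delta_mx 0 0).
  have := row_equiv_map (nagata_inv K N n) H; rewrite map_delta_mx -map_mx_comp.
  by rewrite (map_mx_id (@nagataK K N n)).
have FU : F *m map_mx (nagata K N n) (c%:MP^-1 *: u) = 1%:M.
  by rewrite -map_mxM -scalemxAr -scalemxAl scalerA mulVr // scale1r fu map_mx1.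
have mF : F 0 0 \is monic by rewrite !mxE rmorphM /= mmapC.
apply: row_equiv_trans (row_equiv_horner0 mF FU) _.
(* At 0 only the [n] variables of the coefficients remain, and evaluation preserves
   unimodularity. *)
have -> : row_at 0 F = map_mx polyC (map_mx (horner_eval 0) F).
  by apply/rowP => k; rewrite !mxE comp_poly0r /horner_eval horner_coef0.
have /IH /(row_equiv_map polyC) : map_mx (horner_eval 0) F *m
    map_mx (horner_eval 0) (map_mx (nagata K N n) (c%:MP^-1 *: u)) = 1%:M.
  by rewrite -map_mxM FU map_mx1.
by rewrite map_delta_mx.
Qed.

(** * Bases of submodules of a row module *)

Definition row_basis (A : nzRingType) r n (M : 'rV[A]_n -> Prop)
    (W : 'M[A]_(r, n)) : Prop :=
  (forall x : 'rV_r, x *m W = 0 -> x = 0) /\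
  (forall v, M v <-> exists x : 'rV_r, v = x *m W).

Definition seq_mx (A : nzRingType) n (s : seq 'rV[A]_n) : 'M[A]_(size s, n) :=
  \matrix_(i < size s) nth 0 s i.

Lemma mul_seq_mx (A : nzRingType) n (s : seq 'rV[A]_n) (a : 'rV[A]_n -> A) :
  (\row_i a (nth 0 s i)) *m seq_mx s = \sum_(b <- s) a b *: b.
Proof.
rewrite mulmx_sum_row (big_nth 0) big_mkord; apply: eq_bigr => i _.
by rewrite mxE rowK.
Qed.

(** [lin_indep] indexes coefficients by vectors, matrices index them by positions; without
    repetitions the two agree. *)
Lemma uniq_row_fun (A : nzRingType) (V : eqType) (z : V) (s : seq V)
    (x : 'rV[A]_(size s)) :
  uniq s -> exists a : V -> A, x = \row_i a (nth z s i).
Proof.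
move=> us; exists (fun b => if insub (index b s) is Some i then x 0 i else 0).
by apply/rowP => i; rewrite mxE index_uniq // valK.
Qed.

(** Padding [W] with a zero column gives a square matrix of determinant 0. *)
Lemma kernel_nontrivial (A : idomainType) n (W : 'M[A]_(n.+1, n)) :
  exists2 x : 'rV_n.+1, x != 0 & x *m W = 0.
Proof.
pose W' : 'M[A]_n.+1 :=
  \matrix_(i, j) if unlift ord0 j is Some k then W i k else 0.
have /eqP/det0P [x x0 xW] : \det W' = 0.
  by rewrite (expand_det_col _ ord0) big1 // => i _; rewrite mxE unlift_none mul0r.
exists x => //; apply/rowP => k.
have := congr1 (fun y : 'rV_n.+1 => y 0 (lift ord0 k)) xW; rewrite !mxE => xWk.
rewrite -[RHS]xWk.
by apply: eq_bigr => i _; rewrite !mxE liftK.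
Qed.

Lemma lin_indep_size (A : idomainType) n (B : 'rV[A]_n -> Prop) s :
  lin_indep B -> uniq s -> (forall b, b \in s -> B b) -> (size s <= n)%N.
Proof.
move=> indB us sB; rewrite leqNgt; apply/negP => lt_ns.
pose t := take n.+1 s.
have ut : uniq t by apply: take_uniq.
have tB b : b \in t -> B b by move/mem_take/sB.
have st : size t = n.+1 by rewrite size_takel.
have [x x0 xW] := kernel_nontrivial (castmx (st, erefl n) (seq_mx t)).
have [a aE] := uniq_row_fun 0 (castmx (erefl 1%N, esym st) x) ut.
have := indB t a ut tB; rewrite -mul_seq_mx -aE => a0.
case/negP: x0; apply/eqP.
have E : castmx (erefl 1%N, esym st) x *m seq_mx t = 0.
  by move: xW; case: _ / st x {aE a0} => x; rewrite !castmx_id.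
suff : castmx (erefl 1%N, esym st) x = 0.
  by case: _ / st x {aE a0 xW E} => x; rewrite castmx_id.
by apply/rowP => i; rewrite aE !mxE a0 // mem_nth.
Qed.

(** Duplicate-free lists in [B] have length at most [n]; a longest one exhausts [B], since any
    missing element could be added to it. *)
Lemma lin_indep_finite (A : idomainType) n (B : 'rV[A]_n -> Prop) :
  lin_indep B -> exists2 s, uniq s & forall b, b \in s <-> B b.
Proof.
move=> indB.
pose P k := `[< exists s, [/\ uniq s, forall b, b \in s -> B b & size s = k] >].
have exP : exists k, P k by exists 0%N; apply/asboolP; exists [::].
have leP k : P k -> (k <= n)%N.
  by case/asboolP => s [us sB <-]; apply: lin_indep_size indB us sB.
have [k /asboolP [s [us sB sk]] maxk] := ex_maxnP exP leP.
exists s => // b; split; first exact: sB.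
move=> Bb; apply: contrapT => /negP nbs.
have /maxk : P k.+1; last by rewrite ltnn.
apply/asboolP; exists (b :: s); split=> [|x|]; rewrite /= ?nbs ?sk //.
by rewrite inE => /predU1P [->|/sB].
Qed.

Lemma is_freeP (A : idomainType) n (M : 'rV[A]_n -> Prop) :
  is_free M <-> exists r (W : 'M[A]_(r, n)), row_basis M W.
Proof.
split=> [[B [indB MB]]|[r [W [freeW MW]]]].
  have [s us sB] := lin_indep_finite indB.
  exists (size s), (seq_mx s); split=> [x xs0|v].
    have [a aE] := uniq_row_fun 0 x us; apply/rowP => i.
    have sB' b : b \in s -> B b by move/sB.
    have := indB s a us sB'; rewrite -mul_seq_mx -aE => /(_ xs0) a0.
    by rewrite aE !mxE a0 // mem_nth.
  rewrite MB; split=> [[t [a [tB ->]]]|[x ->]].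
    (* The list [t] may have repetitions, so coordinates are summed term by term. *)
    rewrite big_seq; apply: (big_ind (fun v => exists x, v = x *m seq_mx s)).
    - by exists 0; rewrite mul0mx.
    - by move=> _ _ [x ->] [y ->]; exists (x + y); rewrite mulmxDl.
    move=> b /tB/sB bs; have ib : (index b s < size s)%N by rewrite index_mem.
    exists (a b *: delta_mx 0 (Ordinal ib)); rewrite -scalemxAl -rowE rowK /=.
    by rewrite nth_index.
  have [a ->] := uniq_row_fun 0 x us.
  by exists s, a; split; [move=> b /sB|rewrite mul_seq_mx].
have row_inj : injective (fun i => row i W).
  move=> i j; rewrite !rowE => /eqP; rewrite -subr_eq0 -mulmxBl => /eqP/freeW.
  move/rowP/(_ i); rewrite !mxE !eqxx /=; case: eqVneq => // _ /eqP.
  by rewrite subr0 oner_eq0.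
(* [f] recovers the index of a row; the rows are distinct because [W] has trivial kernel. *)
pose f b := [pick i | row i W == b].
have fK i : f (row i W) = Some i.
  rewrite /f; case: pickP => [j /eqP/row_inj -> //|/(_ i)].
  by rewrite eqxx.
exists (fun b => exists i, b = row i W); split.
  move=> s a us sW; pose x := \sum_(b <- s)
    (if f b is Some i then a b *: delta_mx 0 i else 0) : 'rV[A]_r.
  have -> : \sum_(b <- s) a b *: b = x *m W.
    rewrite mulmx_suml !big_seq; apply: eq_bigr => b /sW [i ->].
    by rewrite fK -scalemxAl -rowE.
  move/freeW => x0 b bs; have [i bE] := sW b bs.
  have := congr1 (fun y : 'rV_r => y 0 i) x0; rewrite [RHS]mxE summxE.
  rewrite (bigD1_seq b) //= {1}bE fK !mxE !eqxx mulr1 big_seq_cond big1 ?addr0 //.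
  move=> d /andP[/sW [j dE] ndb]; rewrite dE fK !mxE eqxx /=.
  by rewrite (_ : (i == j) = false) ?mulr0 //; apply: contraNF ndb => /eqP ij;
    rewrite dE bE ij.
move=> v; rewrite MW; split=> [[x ->]|[s [a [sW ->]]]].
  exists [seq row i W | i <- enum 'I_r],
    (fun b => if f b is Some i then x 0 i else 0).
  split=> [b /mapP [i _ ->]|]; first by exists i.
  by rewrite big_map big_enum mulmx_sum_row; apply: eq_bigr => i _; rewrite fK.
rewrite big_seq; apply: (big_ind (fun v => exists x, v = x *m W)).
- by exists 0; rewrite mul0mx.
- by move=> _ _ [x ->] [y ->]; exists (x + y); rewrite mulmxDl.
move=> b /sW [i ->]; exists (a (row i W) *: delta_mx 0 i).
by rewrite -scalemxAl -rowE.
Qed.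

(** * Logarithmic derivations *)

Lemma der_app_is_linear (K : fieldType) n (g : {mpoly K[n]}) a
    (u v : derivation K n) :
  der_app (a *: u + v) g = a * der_app u g + der_app v g.
Proof.
rewrite /der_app mulr_sumr -big_split; apply: eq_bigr => j _ /=.
by rewrite !mxE mulrDl mulrA.
Qed.

Lemma der_app_mulmx (K : fieldType) n (g : {mpoly K[n]}) r (x : 'rV_r)
    (W : 'M[{mpoly K[n]}]_(r, n)) :
  der_app (x *m W) g = (x *m \col_i der_app (row i W) g) 0 0.
Proof.
rewrite mxE /der_app; under eq_bigr do rewrite mxE mulr_suml.
rewrite exchange_big; apply: eq_bigr => i _; rewrite mxE mulr_sumr.
by apply: eq_bigr => j _; rewrite mxE mulrA.
Qed.

Section Decomposition.
Variables (K : fieldType) (n : nat) (g : {mpoly K[n]}) (eps : derivation K n).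
Variable c : K.
Hypotheses (g0 : g != 0) (c0 : c != 0) (epsg : der_app eps g = c *: g).

Lemma der_app_eps_eq0 a : der_app (a *: eps) g = 0 -> a = 0.
Proof.
rewrite -[a *: eps]addr0 der_app_is_linear epsg.
have -> : der_app 0 g = 0 by rewrite /der_app big1 // => j _; rewrite mxE mul0r.
move/eqP; rewrite addr0 mulf_eq0 scaler_eq0 (negPf g0) (negPf c0) !orbF.
by move/eqP.
Qed.

Lemma Der_decomposition : is_direct_sum (Der g) (Der0 g) (cyclic_submod eps).
Proof.
split=> [v|v v0 [a va]]; last first.
  by rewrite va (@der_app_eps_eq0 a) ?scale0r // -va.
split=> [[h vh]|[u [w [u0 [a ->] ->]]]]; last first.
  exists (a * c%:MP); rewrite addrC der_app_is_linear u0 addr0 epsg.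
  by rewrite -mul_mpolyC mulrA.
exists (v - (c^-1 *: h) *: eps), ((c^-1 *: h) *: eps); split.
- rewrite /Der0 addrC -scaleNr der_app_is_linear epsg vh mulNr.
  by rewrite -scalerAl -scalerAr scalerA mulVf // scale1r addNr.
- by exists (c^-1 *: h).
- by rewrite subrK.
Qed.

Lemma A_free_A0_free : A_free g -> A0_free g.
Proof.
move=> /is_freeP [r [W [freeW DW]]]; apply/is_freeP.
have hP i : exists h, der_app (row i W) g = h * g.
  by apply/DW; exists (delta_mx 0 i); rewrite rowE.
pose h : 'cV_r := \col_i sval (cid (hP i)).
have DWg (x : 'rV_r) : der_app (x *m W) g = (x *m h) 0 0 * g.
  rewrite der_app_mulmx !mxE mulr_suml; apply: eq_bigr => i _.
  by rewrite !mxE -mulrA; congr (_ * _); exact: svalP (cid (hP i)).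
have [e eE] : exists e, eps = e *m W.
  by apply/DW; exists c%:MP; rewrite mul_mpolyC.
(* Comparing the two values of [eps] on [g] and cancelling [g] makes [h] unimodular up to the unit
   [c]. *)
have eh : e *m h = c%:MP%:M.
  rewrite [LHS]mx11_scalar; congr _%:M; apply: (mulIf g0).
  by rewrite -DWg -eE epsg mul_mpolyC.
have uc : (c%:MP : {mpoly K[n]}) \is a GRing.unit.
  by apply: (rmorph_unit (@mpolyC n K)); rewrite unitfE.
(* An empty basis would force [c = 0]. *)
case: r => [|r] in W freeW DW hP h DWg e eE eh *.
  move/matrixP/(_ 0 0): eh; rewrite !mxE big_ord0 => /esym/eqP.
  by rewrite mulr1n mpolyC_eq0 (negPf c0).
have [|P uP hE] := @unimodular_row_completable K n r h^T (c%:MP^-1 *: e^T).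
  by rewrite -scalemxAr -trmx_mul eh tr_scalar_mx scale_scalar_mx mulVr.
have uPT : P^T \in unitmx by rewrite unitmx_tr.
(* In the coordinates [x *m P^T], the multiplier of [g] is the first coordinate. *)
have xh (x : 'rV_r.+1) : (x *m h) 0 0 = (x *m P^T) 0 0.
  by rewrite -[h]trmxK hE trmx_mul mulmxA trmx_delta -colE mxE.
(* The rows of [W1] form the adapted basis of [Der g]; [Der0 g] is where the first coordinate
   vanishes, so the rows after the first are a basis of it. *)
pose W1 : 'M_(1 + r, n) := invmx P^T *m W.
exists r, (dsubmx W1); split=> [y yW|v].
  have /freeW : (row_mx 0 y : 'rV_(1 + r)) *m invmx P^T *m W = 0.
    by rewrite -mulmxA -/W1 -[W1]vsubmxK mul_row_col mul0mx add0r.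
  move/(congr1 (mulmx^~ P^T)); rewrite mulmxKV // mul0mx.
  by move/(congr1 (@rsubmx _ 1 1 r)); rewrite row_mxKr linear0.
split=> [v0|[y ->]].
  have [x xE] : exists x, v = x *m W by apply/DW; exists 0; rewrite mul0r.
  have /eqP := v0; rewrite /Der0 xE DWg mulf_eq0 (negPf g0) orbF xh => /eqP x0.
  pose z : 'rV_(1 + r) := x *m P^T.
  exists (rsubmx z); have -> : x *m W = z *m W1 by rewrite mulmxA mulmxK.
  rewrite -{1}[z]hsubmxK -{1}[W1]vsubmxK mul_row_col.
  have -> : lsubmx z = 0; last by rewrite mul0mx add0r.
  apply/rowP => i; rewrite [LHS]mxE [RHS]mxE (ord1 i) -[RHS]x0.
  by congr (z 0 _); exact: val_inj.
rewrite /Der0.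
have -> : y *m dsubmx W1 = (row_mx 0 y : 'rV_(1 + r)) *m invmx P^T *m W.
  by rewrite -mulmxA -/W1 -{2}[W1]vsubmxK mul_row_col mul0mx add0r.
rewrite DWg xh mulmxKV //.
have -> : (row_mx 0 y : 'rV_(1 + r)) 0 0 = 0; last by rewrite mul0r.
have <- : (0 : 'rV[{mpoly K[n]}]_1) 0 0 = 0 by rewrite mxE.
by rewrite -(row_mxEl 0 y 0 0); congr (_ _ _); exact: val_inj.
Qed.

Lemma A0_free_A_free : A0_free g -> A_free g.
Proof.
move=> /is_freeP [r [W [freeW DW]]]; apply/is_freeP.
have [Dsum Dint] := Der_decomposition.
exists (1 + r)%N, (col_mx eps W); split=> [x|v].
  rewrite -[x]hsubmxK mul_row_col [lsubmx x]mx11_scalar mul_scalar_mx.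
  set a := lsubmx x 0 0; set y := rsubmx x => /eqP; rewrite addr_eq0 => /eqP E.
  (* [a *: eps] equals [- y *m W], hence kills [g]. *)
  have a0 : a = 0.
    apply: der_app_eps_eq0; rewrite E -mulNmx.
    by apply/DW; exists (- y).
  move/eqP: E; rewrite a0 scale0r eq_sym oppr_eq0 => /eqP/freeW ->.
  by rewrite -scalemx1 scale0r row_mx0.
rewrite Dsum; split=> [[_ [_ [/DW [y ->] [a ->] ->]]]|[x ->]].
  by exists (row_mx a%:M y); rewrite mul_row_col mul_scalar_mx addrC.
rewrite -[x]hsubmxK mul_row_col [lsubmx x]mx11_scalar mul_scalar_mx addrC.
exists (rsubmx x *m W), (lsubmx x 0 0 *: eps); split=> //.
- by apply/DW; exists (rsubmx x).
- by exists (lsubmx x 0 0).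
Qed.

End Decomposition.

Local Open Scope complex_scope.

Theorem proposition3p3 (R : realType) (n : nat) (g : {mpoly R[i][n]})
    (eps : derivation R[i] n) (c : R[i]) :
  nonconstant g -> squarefree g ->
  Der g eps -> c != 0 -> der_app eps g = c *: g ->
  is_direct_sum (Der g) (Der0 g) (cyclic_submod eps) /\
  (A_free g <-> A0_free g).
Proof.
move=> g_nonconst _ _ c0 epsg.
have g0 : g != 0 by apply/eqP => g0; apply: (g_nonconst 0); rewrite mpolyC0.
split; first exact: Der_decomposition g0 c0 epsg.
split; [exact: A_free_A0_free g0 c0 epsg|exact: A0_free_A_free g0 c0 epsg].
Qed.
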